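(* Let $G=(V,E)$ be a finite connected directed graph and let $c\in\mathbb{R}^{|E|}$. Then the circuit diameter of the dual network flow polyhedron $P_{G,c}$ satisfies $$\operatorname{diam}_{\mathcal{C}}(P_{G,c})\;\le\;\frac{|V|\cdot(|V|-1)}{2}.$$
   Context: Directed graphs are finite, without loops and without parallel arcs: $E$ is a set of ordered pairs $ab$ of distinct nodes $a,b\in V$ (arc from tail $a$ to head $b$); both $ab$ and $ba$ may be present. ''Connected'' means that the underlying undirected graph is connected. One node of $V$ is designated as node $0$. For $c\in\mathbb{R}^{|E|}$ (with arbitrary real entries $c_{ab}$, $ab\in E$), the dual network flow polyhedron is $$P_{G,c}=\{u\in\mathbb{R}^{|V|}: -u_a+u_b\le c_{ab}\ \text{ for all } ab\in E,\ u_0=0\}.$$ Circuits. For a polyhedron $P=\{z\in\mathbb{R}^n: A^1z=b^1,\ A^2z\ge b^2\}$ with rational matrices $A^1,A^2$, the set of circuits $\mathcal{C}(A^1,A^2)$ consists of those vectors $g\in\ker(A^1)\setminus\{0\}$, normalized to coprime integer components, for which $A^2g$ is support-minimal in the set $\{A^2x: x\in\ker(A^1)\setminus\{0\}\}$. For $P_{G,c}$ the matrices are those of its defining description above: $A^1u=b^1$ is the equation $u_0=0$ and $A^2u\ge b^2$ is the system $u_a-u_b\ge -c_{ab}$, $ab\in E$. Note that if $g$ is a circuit, so is $-g$. Circuit walks. For vertices $v^{(1)},v^{(2)}$ of $P$, a circuit walk of length $k$ from $v^{(1)}$ to $v^{(2)}$ is a sequence $v^{(1)}=y^{(0)},\dots,y^{(k)}=v^{(2)}$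 such that for all $i=0,\dots,k-1$: (1) $y^{(i)}\in P$; (2) $y^{(i+1)}-y^{(i)}=\alpha_i g^{(i)}$ for some $g^{(i)}\in\mathcal{C}(A^1,A^2)$ and $\alpha_i>0$; (3) $y^{(i)}+\alpha g^{(i)}\notin P$ for all $\alpha>\alpha_i$. The circuit distance from $v^{(1)}$ to $v^{(2)}$ is the minimum length of a circuit walk from $v^{(1)}$ to $v^{(2)}$, and the circuit diameter $\operatorname{diam}_{\mathcal{C}}(P)$ is the maximum circuit distance between any two vertices of $P$. (If $P_{G,c}$ is empty there are no vertices and the statement is vacuous.) *)

(* Defs.v *)
(* Mathematical Components, with the extended reals of MathComp-Analysis. *)
From mathcomp Require Import all_boot all_order all_algebra.
From mathcomp Require Import boolp classical_sets reals ereal.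

Set Implicit Arguments.
Unset Strict Implicit.
Unset Printing Implicit Defensive.

Import Order.TTheory GRing.Theory Num.Theory.
Local Open Scope classical_set_scope.
Local Open Scope ring_scope.

(* The description is part of the data, because circuits depend on it and not
   only on the set of solutions. *)
Record polyhedron (R : realType) (n : nat) := Polyhedron {
  eq_size : nat;
  ineq_size : nat;
  eq_mx : 'M[R]_(eq_size, n);
  eq_rhs : 'cV[R]_eq_size;
  ineq_mx : 'M[R]_(ineq_size, n);
  ineq_rhs : 'cV[R]_ineq_size }.

Definition points (R : realType) (n : nat) (P : polyhedron R n) :
    set 'cV[R]_n :=
  [set z | eq_mx P *m z = eq_rhs P /\
           forall i, ineq_rhs P i 0 <= (ineq_mx P *m z) i 0].

(* Vertices are the extreme points. *)
Definition vertices (R : realType) (n : nat) (P : polyhedron R n) :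
    set 'cV[R]_n :=
  [set v | points P v /\
     forall (x y : 'cV[R]_n) (t : R), points P x -> points P y ->
       0 < t -> t < 1 -> v = t *: x + (1 - t) *: y -> x = y].

Definition support (R : realType) (m : nat) (x : 'cV[R]_m) : {set 'I_m} :=
  [set i | x i 0 != 0]%SET.

(* Coprimality is collective: the gcd of all the components is 1. *)
Definition coprime_integral (R : realType) (n : nat) (g : 'cV[R]_n) : Prop :=
  exists2 z : 'cV[int]_n,
    g = map_mx intr z & \big[gcdn/0%N]_i absz (z i 0) = 1%N.

Definition circuits (R : realType) (n : nat) (P : polyhedron R n) :
    set 'cV[R]_n :=
  [set g | [/\ eq_mx P *m g = 0, g != 0, coprime_integral g &
     forall x : 'cV[R]_n, eq_mx P *m x = 0 -> x != 0 ->
       ~~ (support (ineq_mx P *m x) \proper support (ineq_mx P *m g))]].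

Definition circuit_step (R : realType) (n : nat) (P : polyhedron R n)
    (y y' : 'cV[R]_n) : Prop :=
  points P y /\
  exists (g : 'cV[R]_n) (alpha : R),
    [/\ circuits P g, 0 < alpha, y' - y = alpha *: g &
        forall beta : R, alpha < beta -> ~ points P (y + beta *: g)].

(* Only the values y 0, ..., y k matter. *)
Definition circuit_walk (R : realType) (n : nat) (P : polyhedron R n)
    (k : nat) (v w : 'cV[R]_n) : Prop :=
  exists y : nat -> 'cV[R]_n,
    [/\ y 0%N = v, y k = w &
        forall i, (i < k)%N -> circuit_step P (y i) (y i.+1)].

(* +oo if there is no circuit walk from v to w. *)
Definition circuit_distance (R : realType) (n : nat) (P : polyhedron R n)
    (v w : 'cV[R]_n) : \bar R :=
  ereal_inf [set (k%:R)%:E | k in [set k : nat | circuit_walk P k v w]].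

(* -oo if P has no vertices. *)
Definition circuit_diameter (R : realType) (n : nat) (P : polyhedron R n) :
    \bar R :=
  ereal_sup [set d | exists v w : 'cV[R]_n,
    [/\ vertices P v, vertices P w & d = circuit_distance P v w]].

(* A directed graph on V is its set of arcs (tail, head). *)
Definition loopless (V : finType) (E : {set V * V}) : Prop :=
  forall a b : V, (a, b) \in E -> a != b.

Definition connected_digraph (V : finType) (E : {set V * V}) : Prop :=
  forall a b : V,
    connect [rel x y | ((x, y) \in E) || ((y, x) \in E)] a b.

(* The coordinate of node a is enum_rank a, and row i of the inequality system
   belongs to the arc enum_val i; for an arc ab it reads u_a - u_b >= - c_ab. *)
Definition dual_network_flow (R : realType) (V : finType) (E : {set V * V})
    (node0 : V) (c : 'cV[R]_#|E|) : polyhedron R #|V| :=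
  {| eq_mx := \row_j (j == enum_rank node0)%:R;
     eq_rhs := 0;
     ineq_mx := \matrix_(i < #|E|, j < #|V|)
       ((j == enum_rank (enum_val i).1)%:R
        - (j == enum_rank (enum_val i).2)%:R);
     ineq_rhs := - c |}.

Lemma points_dual_network_flow (R : realType) (V : finType)
    (E : {set V * V}) (node0 : V) (c : 'cV[R]_#|E|) (u : 'cV[R]_#|V|) :
  points (dual_network_flow node0 c) u <->
  u (enum_rank node0) 0 = 0 /\
  forall i : 'I_#|E|,
    - u (enum_rank (enum_val i).1) 0 + u (enum_rank (enum_val i).2) 0 <= c i 0.
Proof.
have sumE (k : 'I_#|V|) : \sum_j (j == k)%:R * u j 0 = u k 0.
  rewrite (bigD1 k) //= eqxx mul1r big1 ?addr0 // => j /negPf ->.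
  by rewrite mul0r.
have eqE : (eq_mx (dual_network_flow node0 c) *m u) 0 0
    = u (enum_rank node0) 0.
  by rewrite mxE -[RHS]sumE; apply: eq_bigr => j _; rewrite mxE.
have ineqE i : (ineq_mx (dual_network_flow node0 c) *m u) i 0 =
    u (enum_rank (enum_val i).1) 0 - u (enum_rank (enum_val i).2) 0.
  rewrite mxE -!sumE -sumrB; apply: eq_bigr => j _.
  by rewrite mxE mulrBl.
have leE i : (ineq_rhs (dual_network_flow node0 c) i 0 <=
      (ineq_mx (dual_network_flow node0 c) *m u) i 0) =
    (- u (enum_rank (enum_val i).1) 0 + u (enum_rank (enum_val i).2) 0
      <= c i 0).
  by rewrite ineqE /= mxE lerNl opprB addrC.
split=> [[u0 uE]|[u0 uE]]; split.
- by rewrite -eqE u0 mxE.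
- by move=> i; rewrite -leE.
- by apply/matrixP => i j; rewrite !ord1 eqE u0 mxE.
- by move=> i; rewrite leE.
Qed.

(* Main.v *)
(* Let w be the target vertex and u the current point. As w is extreme, its tight
   arcs connect V, so a set K on which u - w is constant, starting from {node0},
   can be enlarged along an arc ab tight at w that crosses K. Say b is in K.
   Grow S from K by adding the tails of arcs that enter S and are tight at u; if
   there is none, raise the complement of the component of V - S containing a.
   This is a circuit step, it changes u - w on S by a constant only, and it ends
   when an arc into S becomes tight. When a enters S, tightness forces
   (u - w)(a) = (u - w)(b). Enlarging K thus takes at most
   |V| - |K| steps, and these bounds add up to |V|(|V| - 1)/2. The case a in K is
   the same one for the reversed arcs and negated potentials. *)
Require Import Defs.
From mathcomp Require Import all_boot all_order all_algebra.
From mathcomp Require Import boolp classical_sets reals ereal.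
From mathcomp Require Import fintype finset zify lra.

Set Implicit Arguments.
Unset Strict Implicit.
Unset Printing Implicit Defensive.

Import Order.TTheory GRing.Theory Num.Theory.
Local Open Scope ring_scope.

(** Arcs are given by an index type, so that reversing them swaps two fields and leaves the costs in
    place. *)
Record network (R : realDomainType) (V I : finType) := Network {
  tail : I -> V;
  head : I -> V;
  cost : I -> R }.

Definition rev_network (R : realDomainType) (V I : finType)
  (N : network R V I) := Network (head N) (tail N) (cost N).

(** * Connected node sets and cuts with two connected sides *)

Section Connectivity.
Variables (R : realDomainType) (V I : finType).
Implicit Types (N : network R V I) (A B S C : {set V}).

(* Connectivity of the subgraph induced by [A], through its cuts. *)
Definition uncut N A B :=
  forall i, tail N i \in A -> head N i \in A ->
    (tail N i \in B) = (head N i \in B).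

Definition conn N A :=
  forall B, uncut N A B -> forall z, z \in A -> z \in B -> A \subset B.

Lemma conn_rev N A : conn N A -> conn (rev_network N) A.
Proof. by move=> cA B clB; apply: cA => i ti hi; rewrite -clB. Qed.

Lemma conn1 N a : conn N [set a].
Proof. by move=> B _ z /set1P-> aB; rewrite sub1set. Qed.

Lemma conn_setU_arc N S i :
  conn N S -> (tail N i \in S) || (head N i \in S) ->
  conn N ([set tail N i; head N i] :|: S).
Proof.
move=> cS iS B clB z zS' zB.
have eqi : (tail N i \in B) = (head N i \in B).
  by apply: clB; rewrite !inE eqxx ?orbT.
have clS : uncut N S B by move=> j tj hj; apply: clB; rewrite !inE ?tj ?hj !orbT.
have SB : S \subset B.
  have [zS|zS] := boolP (z \in S); first exact: cS zB.
  have tB : tail N i \in B.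
    by move: zS' zB; rewrite !inE (negPf zS) orbF => /orP[] /eqP->; rewrite ?eqi.
  by case/orP: iS => iS; apply: cS iS _; rewrite -?eqi.
have tB : tail N i \in B.
  by case/orP: iS => /(subsetP SB) //; rewrite eqi.
by rewrite !subUset !sub1set SB -eqi tB.
Qed.

(** [C] is the component of [~: S] containing [a], found as a maximal connected set around [a] that
    avoids [S]. Its complement is connected because from any node outside [C] the connected set [S]
    is reached without entering [C]. *)
Lemma conn_component N S s a :
  conn N setT -> conn N S -> s \in S -> a \notin S ->
  exists C, [/\ a \in C, [disjoint C & S], conn N C, conn N (~: C) &
    forall i, tail N i \in C -> head N i \notin C -> head N i \in S].
Proof.
move=> cT cS sS aS.
pose P C := `[< conn N C >] && [disjoint C & S].
have Pa : P [set a] by rewrite /P disjoints1 aS andbT; apply/asboolP/conn1.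
have [C /maxsetP[/andP[/asboolP cC dC] maxC] aC] := maxset_exists Pa.
rewrite sub1set in aC.
(* An arc with exactly one end in [C] and none in [S] could be added to [C], against maximality. *)
have bd i : (tail N i \in C) != (head N i \in C) ->
    (tail N i \in S) || (head N i \in S).
  move=> iC; apply/negPn/negP; rewrite negb_or => /andP[tS hS].
  have CE : [set tail N i; head N i] :|: C = C.
    apply: maxC; last exact: subsetUr.
    apply/andP; split.
      apply/asboolP/conn_setU_arc => //.
      by case: (_ \in C) (_ \in C) iC => -[].
    rewrite -setI_eq0; apply/eqP/setP => x; rewrite !inE.
    have [xS|] := boolP (x \in S); last by rewrite andbF.
    rewrite (disjointFl dC xS) orbF andbT.
    by apply/negP => /orP[] /eqP xE; move: xS; rewrite xE (negPf tS, negPf hS).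
  have tC : tail N i \in C by rewrite -CE !inE eqxx.
  have hC : head N i \in C by rewrite -CE !inE eqxx orbT.
  by rewrite tC hC in iC.
have bdt i : tail N i \in C -> head N i \notin C -> head N i \in S.
  move=> tC hC; have := bd i; rewrite tC (negPf hC) => /(_ isT).
  by rewrite (disjointFr dC tC).
have bdh i : head N i \in C -> tail N i \notin C -> tail N i \in S.
  move=> hC tC; have := bd i; rewrite hC (negPf tC) => /(_ isT).
  by rewrite (disjointFr dC hC) orbF.
exists C; split=> // B clB z; rewrite inE => zC zB.
(* If [B] missed [S], no arc would join [B :\: C] to the rest of the graph, since every arc across
   the boundary of [C] has its other end in [S]. *)
have [x xS xB] : exists2 x, x \in S & x \in B.
  apply/exists_inP; apply: contraT; rewrite negb_exists_in => /forall_inP SB.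
  suff /subsetP/(_ a (in_setT _)) : setT \subset B :\: C by rewrite inE aC.
  apply: (cT _ _ z); rewrite ?inE ?zC // => i _ _; rewrite !inE.
  have [tC|tC] := boolP (tail N i \in C); have [hC|hC] := boolP (head N i \in C) => //=.
  - by apply/esym/negbTE/SB/bdt.
  - by apply/negbTE/SB/bdh.
  - by apply: clB; rewrite inE.
have SC : S \subset ~: C by rewrite -disjoints_subset disjoint_sym.
have SB : S \subset B.
  by apply: cS xS xB => i tS hS; apply: clB; apply: (subsetP SC).
suff /subsetP BC : setT \subset B :|: C.
  by apply/subsetP => y; have := BC y; rewrite !inE => /(_ isT)/orP[//|->].
apply: (cT _ _ a); rewrite ?inE ?aC ?orbT // => i _ _; rewrite !inE.
have [tC|tC] := boolP (tail N i \in C); have [hC|hC] := boolP (head N i \in C);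
  rewrite ?orbT ?orbF //.
- by apply/esym/(subsetP SB)/bdt.
- by apply/(subsetP SB)/bdh.
- by apply: clB; rewrite inE.
Qed.
End Connectivity.

(** * Walks along cut directions towards a target potential *)

Section Walks.
Variables (R : realDomainType) (V I : finType) (r : V).
Implicit Types (N : network R V I) (A S K : {set V}) (u w : V -> R).

Definition feasible N u := forall i, u (head N i) - u (tail N i) <= cost N i.

Definition tight N u i := u (head N i) - u (tail N i) = cost N i.

Definition agree_on u w S := {in S &, forall x y : V, u x - w x = u y - w y}.

(* Up to sign, the indicator of the side of the cut that avoids [r]: the direction
   that raises [A] relative to its complement and fixes the potential of [r]. *)
Definition cutv A x : R := (x \in A)%:R - (r \in A)%:R.

(** The arc [i] certifies maximality: it enters [A] and is tight at [u'], so a longer step would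
    violate its constraint. *)
Definition cut_step N u u' :=
  exists A alpha, [/\ conn N A, conn N (~: A), 0 < alpha,
    forall x, u' x = u x + alpha * cutv A x &
    exists i, [/\ tail N i \notin A, head N i \in A & tight N u' i]].

Inductive cut_walk N : nat -> (V -> R) -> (V -> R) -> Prop :=
| CutWalk0 u : feasible N u -> cut_walk N 0 u u
| CutWalkS k u u' u'' : feasible N u -> cut_step N u u' ->
    cut_walk N k u' u'' -> cut_walk N k.+1 u u''.

Lemma cut_walk_cat N k l u u' u'' :
  cut_walk N k u u' -> cut_walk N l u' u'' -> cut_walk N (k + l) u u''.
Proof.
by elim=> // {}k {}u v {}u' uF uv _ IH /IH vu''; apply: CutWalkS uF uv vu''.
Qed.

Lemma cut_walk_root N k u u' : cut_walk N k u u' -> u' r = u r.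
Proof.
elim=> // {}k {}u v {}u' _ [A [alpha [_ _ _ vE _]]] _ ->.
by rewrite vE /cutv subrr mulr0 addr0.
Qed.

Lemma feasible_rev N u : feasible N u -> feasible (rev_network N) (fun x => - u x).
Proof. by move=> uF i; rewrite /= opprK addrC. Qed.

Lemma tight_rev N u i : tight N u i -> tight (rev_network N) (fun x => - u x) i.
Proof. by rewrite /tight /= opprK addrC. Qed.

Lemma cutvC A x : cutv (~: A) x = - cutv A x.
Proof. by rewrite /cutv !inE; case: (x \in A) (r \in A) => -[] /=; lra. Qed.

Lemma cut_step_rev N u u' :
  cut_step N u u' -> cut_step (rev_network N) (fun x => - u x) (fun x => - u' x).
Proof.
move=> [A [alpha [cA cA' alpha0 u'E [i [ti hi iu']]]]].
exists (~: A), alpha; split=> //; first exact: conn_rev.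
- by rewrite setCK; apply: conn_rev.
- by move=> x; rewrite u'E cutvC; lra.
- by exists i; split; [rewrite inE negbK|rewrite inE|exact: tight_rev].
Qed.

Lemma cut_walk_rev N k u u' : cut_walk N k u u' ->
  cut_walk (rev_network N) k (fun x => - u x) (fun x => - u' x).
Proof.
elim=> [v vF|{}k {}u v {}u' uF uv _ IH]; first exact/CutWalk0/feasible_rev.
apply: CutWalkS IH; [exact: feasible_rev|exact: cut_step_rev].
Qed.

Lemma cut_walk_feasible N k u u' : cut_walk N k u u' -> feasible N u'.
Proof. by elim. Qed.

(** The complement of the component [C] of [~: S] containing [tail N i0] is raised by the least
    slack of an arc leaving [C]. Such arcs all enter [S], so by the last hypothesis this slack is
    positive. *)
Lemma push N S u i0 :
  conn N setT -> conn N S -> feasible N u ->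
  tail N i0 \notin S -> head N i0 \in S ->
  (forall i, tail N i \notin S -> head N i \in S -> ~ tight N u i) ->
  exists u', [/\ cut_step N u u', feasible N u', agree_on u' u S &
    exists i, [/\ tail N i \notin S, head N i \in S & tight N u' i]].
Proof.
move=> cT cS uF t0 h0 nT.
have [C [tC dC cC cC' bd]] := conn_component cT cS h0 t0.
pose slack i := cost N i - (u (head N i) - u (tail N i)).
pose P i := (tail N i \in C) && (head N i \notin C).
have P0 : P i0 by rewrite /P tC (disjointFl dC h0).
case: (arg_minP slack P0) => i /andP[ti hi] slackP.
have tiS : tail N i \notin S by rewrite (disjointFr dC ti).
have hiS : head N i \in S by apply: bd.
have alpha0 : 0 < slack i.
  by rewrite lt_neqAle subr_ge0 uF andbT eq_sym subr_eq0 eq_sym; apply/eqP/nT.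
pose u' x := u x + slack i * cutv (~: C) x.
have u'E x y : u' x - u' y =
    u x - u y + slack i * ((x \notin C)%:R - (y \notin C)%:R).
  by rewrite /u' /cutv !inE; lra.
have iu' : tight N u' i by rewrite /tight u'E ti hi /= /slack; lra.
exists u'; split; last by exists i.
- exists (~: C), (slack i); split=> //; first by rewrite setCK.
  by exists i; rewrite !inE negbK.
- move=> j; rewrite u'E.
  have := uF j; have := slackP j; rewrite /P.
  case: (tail N j \in C) (head N j \in C) => -[] /= sj uj; try by move: alpha0 uj; lra.
  by have := sj isT; rewrite /slack; lra.
- by move=> x y xS yS; have := u'E x y; rewrite !(disjointFl dC) //=; lra.
Qed.

(* [u - w] is at most its value at [head N i0] on all of [S], because each node
   added to [S] has a tight arc into [S]; so [S] reaches the tail of [i0] only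
   when [i0] has become tight. *)
Lemma reach_arc N w i0 K S u :
  conn N setT -> feasible N w -> tight N w i0 ->
  conn N S -> head N i0 \in K -> K \subset S -> feasible N u ->
  agree_on u w K ->
  {in S, forall x, u x - w x <= u (head N i0) - w (head N i0)} ->
  exists k u', [/\ (k <= #|~: S|)%N, cut_walk N k u u' &
    agree_on u' w ([set tail N i0; head N i0] :|: K)].
Proof.
move=> cT wF iw; have [n] := ubnP #|~: S|.
elim: n S u => // n IH S u /ltnSE Sn cS hK KS uF uwK uwS.
have [tS|tS] := boolP (tail N i0 \in S).
  exists 0%N, u; split=> //; first exact: CutWalk0.
  (* One inequality is the bound on [S]; the other is feasibility of [u] at [i0], which is tight for
     [w]. *)
  have eqth : u (tail N i0) - w (tail N i0) = u (head N i0) - w (head N i0).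
    by have := uwS _ tS; have := uF i0; have := iw; rewrite /tight; lra.
  suff H x : x \in [set tail N i0; head N i0] :|: K ->
      u x - w x = u (head N i0) - w (head N i0) by move=> x y /H-> /H->.
  by rewrite !inE => /orP[/orP[]/eqP->//|xK]; exact: uwK.
have hS := subsetP KS _ hK.
(* Stated for any [v], to serve both at [u] and after a push. Adding the tail of a tight arc costs
   no step; the [.-1] leaves room for the push. *)
have key v i : feasible N v -> agree_on v w K ->
    {in S, forall x, v x - w x <= v (head N i0) - w (head N i0)} ->
    tail N i \notin S -> head N i \in S -> tight N v i ->
    exists k u', [/\ (k <= #|~: S|.-1)%N, cut_walk N k v u' &
      agree_on u' w ([set tail N i0; head N i0] :|: K)].
  move=> vF vwK vwS ti hi iv; set S' := [set tail N i; head N i] :|: S.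
  have lt : (#|~: S'| < #|~: S|)%N.
    apply/proper_card/properP; split; first by rewrite setCS subsetUr.
    by exists (tail N i); rewrite !inE ?eqxx.
  have [||||k [u' [kS' W A]]] := IH S' v _ _ hK _ vF vwK.
  - lia.
  - by apply: conn_setU_arc; rewrite // hi orbT.
  - exact: subset_trans KS (subsetUr _ _).
  - move=> x; rewrite !inE => /orP[/orP[]/eqP->|]; [|exact: vwS..].
    by have := vwS _ hi; have := wF i; move: iv; rewrite /tight; lra.
  by exists k, u'; split=> //; lia.
have S0 : (0 < #|~: S|)%N by apply/card_gt0P; exists (tail N i0); rewrite inE.
have [[i [ti hi iu]]|nT] := pselect (exists i, [/\ tail N i \notin S,
    head N i \in S & tight N u i]).
  have [k [u' [kS W A]]] := key _ _ uF uwK uwS ti hi iu.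
  by exists k, u'; split=> //; lia.
have [|v [uv vF vE [i [ti hi iv]]]] := push cT cS uF tS hS.
  by move=> i ti hi iu; apply: nT; exists i.
have [||k [u' [kS W A]]] := key v i vF _ _ ti hi iv.
- move=> x y xK yK.
  have := vE _ _ (subsetP KS _ xK) (subsetP KS _ yK).
  by have := uwK _ _ xK yK; lra.
- by move=> x xS; have := vE _ _ xS hS; have := uwS _ xS; lra.
by exists k.+1, u'; split=> //; [lia|exact: CutWalkS W].
Qed.

Lemma extend N w i0 K u :
  conn N setT -> feasible N w -> tight N w i0 -> conn N K ->
  (tail N i0 \in K) || (head N i0 \in K) -> feasible N u -> agree_on u w K ->
  exists k u', [/\ (k <= #|~: K|)%N, cut_walk N k u u' &
    agree_on u' w ([set tail N i0; head N i0] :|: K)].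
Proof.
move=> cT wF iw cK /orP[] iK uF uwK; last first.
  by apply: (reach_arc (S := K)) => // x xK; rewrite (uwK _ _ xK iK).
have uwK' : agree_on (fun x => - u x) (fun x => - w x) K.
  by move=> x y xK yK; have := uwK _ _ xK yK; lra.
have [|||||||||k [u' [kK W A]]] := @reach_arc (rev_network N) (fun x => - w x) i0
  K K (fun x => - u x); rewrite //=; try exact: conn_rev.
- exact: feasible_rev.
- exact: tight_rev.
- exact: feasible_rev.
- by move=> x xK; rewrite (uwK' _ _ xK iK).
exists k, (fun x => - u' x); split=> //.
  (* Reversing twice gives back [N] by computation once [N] is an explicit constructor. *)
  have := cut_walk_rev W; case: N {cT wF iw cK iK uF kK W A} => t h c.
  by under [X in cut_walk _ _ X _]eq_fun do rewrite opprK.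
by rewrite setUC [[set _; _]]setUC -setUC => x y xS yS; have := A _ _ xS yS; lra.
Qed.

(** The hypothesis on cuts says that the arcs tight at [w] connect the graph: while [K] is not
    everything, one of them crosses its boundary and [extend] absorbs its other end. *)
Lemma cut_walk_to N w u :
  conn N setT -> feasible N w ->
  (forall K x z, x \in K -> z \notin K ->
    exists2 i, tight N w i & (tail N i \in K) != (head N i \in K)) ->
  feasible N u -> u r = w r ->
  exists2 k, (k <= 'C(#|V|, 2))%N & cut_walk N k u w.
Proof.
move=> cT wF cutP uF urw.
suff main K u1 : r \in K -> conn N K -> feasible N u1 ->
    agree_on u1 w K -> u1 r = w r ->
    exists2 k, (k <= 'C(#|~: K|.+1, 2))%N & cut_walk N k u1 w.
  have -> : #|V| = #|~: [set r]|.+1.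
    by rewrite cardsC1 prednK //; apply/card_gt0P; exists r.
  apply: main uF _ urw; rewrite ?set11 //; first exact: conn1.
  by move=> x y /set1P-> /set1P->.
have [n] := ubnP #|~: K|.
elim: n K u1 => // n IH K u1 /ltnSE Kn rK cK u1F A u1r.
have [KT|] := boolP (setT \subset K).
  have -> : w = u1.
    by apply/funext => x; have := A x r (subsetP KT _ _) rK; rewrite inE; lra.
  by exists 0%N => //; exact: CutWalk0.
move=> /subsetPn[z _ zK].
have [i iw iK] := cutP K r z rK zK.
have iK' : (tail N i \in K) || (head N i \in K).
  by case: (_ \in K) (_ \in K) iK => -[].
have [k1 [u2 [k1K W1 A2]]] := extend cT wF iw cK iK' u1F A.
have ltK : (#|~: ([set tail N i; head N i] :|: K)| < #|~: K|)%N.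
  apply/proper_card/properP; split; first by rewrite setCS subsetUr.
  case: (boolP (tail N i \in K)) iK => tK; case: (boolP (head N i \in K)) => hK //.
    by exists (head N i); rewrite !inE ?eqxx ?orbT.
  by exists (tail N i); rewrite !inE ?eqxx.
have [|||k2 k2m W2] := IH _ u2 _ _ (conn_setU_arc cK iK') (cut_walk_feasible W1) A2.
- exact: leq_trans ltK Kn.
- by rewrite inE rK orbT.
- by rewrite (cut_walk_root W1).
exists (k1 + k2)%N; last exact: cut_walk_cat W1 W2.
(* With [n = #|~: K|], Pascal's rule reads ['C(n.+1, 2) = 'C(n, 2) + n]: [n] pays for this extension
   and ['C(n, 2)] for the later ones, as fewer than [n] nodes remain outside. *)
rewrite binS bin1 addnC; apply: leq_add k1K => //.
exact: leq_trans k2m (leq_bin2l 2 ltK).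
Qed.
End Walks.

(** * From cut walks to circuit walks of the polyhedron *)

Section DualNetworkFlow.
Variables (R : realType) (V : finType) (E : {set V * V}) (r : V) (c : 'cV[R]_#|E|).
Implicit Types (A K : {set V}) (f : V -> R).

Local Notation P := (dual_network_flow r c).

Definition arc_network : network R V 'I_#|E| :=
  Network (fun i => (enum_val i).1) (fun i => (enum_val i).2) (fun i => c i 0).

Local Notation N := arc_network.

Definition pot_col f : 'cV[R]_#|V| := \col_j f (enum_val j).

Lemma pot_colE f x : pot_col f (enum_rank x) 0 = f x.
Proof. by rewrite mxE enum_rankK. Qed.

Lemma pot_colK (u : 'cV[R]_#|V|) : pot_col (fun x => u (enum_rank x) 0) = u.
Proof. by apply/colP => j; rewrite mxE enum_valK. Qed.

Lemma points_pot_col f : points P (pot_col f) <-> f r = 0 /\ feasible N f.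
Proof.
rewrite points_dual_network_flow pot_colE; split=> -[fr fF]; split=> // i.
  by have := fF i; rewrite !pot_colE addrC.
by have := fF i; rewrite !pot_colE addrC.
Qed.

Lemma sum_delta (u : 'cV[R]_#|V|) k : \sum_j (j == k)%:R * u j 0 = u k 0.
Proof.
rewrite (bigD1 k) //= eqxx mul1r big1 ?addr0 // => j /negPf ->.
by rewrite mul0r.
Qed.

Lemma eq_mx_pot_col f : (Defs.eq_mx P *m pot_col f == 0) = (f r == 0).
Proof.
have E00 : (Defs.eq_mx P *m pot_col f) 0 0 = f r.
  rewrite mxE -pot_colE -[RHS]sum_delta; apply: eq_bigr => j _.
  by rewrite [Defs.eq_mx _ _ _]mxE.
apply/eqP/eqP => [fE|f0]; first by rewrite -E00 fE mxE.
by apply/matrixP => i j; rewrite !ord1 E00 f0 mxE.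
Qed.

Lemma ineq_mx_pot_col f i :
  (ineq_mx P *m pot_col f) i 0 = f (tail N i) - f (head N i).
Proof.
rewrite mxE -(pot_colE f (tail N i)) -(pot_colE f (head N i)) -!sum_delta -sumrB.
by apply: eq_bigr => j _; rewrite [ineq_mx _ _ _]mxE mulrBl.
Qed.

Lemma const_on_conn A f x y :
  conn N A -> (forall i, tail N i \in A -> head N i \in A ->
    f (tail N i) = f (head N i)) ->
  x \in A -> y \in A -> f x = f y.
Proof.
move=> cA fA xA yA; pose B := [set z | f z == f y].
have clB : uncut N A B by move=> i ti hi; rewrite !inE fA.
have yB : y \in B by rewrite inE.
by have /subsetP/(_ x xA) := cA B clB y yA yB; rewrite inE => /eqP.
Qed.

(** If the arc differences of [f] vanish off the cut, then [f] is constant on each of the connected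
    sides, hence with [f r = 0] a multiple of [cutv R r A]. A nonzero multiple has the same support,
    which excludes proper inclusion. *)
Lemma circuits_cutv A p q :
  conn N A -> conn N (~: A) -> p \in A -> q \notin A ->
  circuits P (pot_col (cutv R r A)).
Proof.
move=> cA cA' pA qA; have gr : cutv R r A r = 0 by rewrite /cutv subrr.
have gpq : cutv R r A p - cutv R r A q = 1.
  by rewrite /cutv pA (negPf qA) /=; lra.
split; first by apply/eqP; rewrite eq_mx_pot_col gr.
- apply/eqP => /colP g0; move: gpq.
  by rewrite -(pot_colE _ p) -(pot_colE _ q) !g0 !mxE; lra.
- exists (\col_j ((enum_val j \in A)%:R - (r \in A)%:R)).
    by apply/colP => j; rewrite !mxE rmorphB /= !mulrz_nat.
  (* On the side of the cut that avoids [r] the entry is 1 or -1, which forces the gcd to be 1. *)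
  pose z := if r \in A then q else p.
  rewrite (bigD1 (enum_rank z)) //= mxE enum_rankK.
  suff -> : absz ((z \in A)%:R - (r \in A)%:R) = 1%N by rewrite gcd1n.
  by rewrite /z; case: ifP => _; rewrite ?pA ?(negPf qA).
move=> x; rewrite -(pot_colK x); move: (fun y => x (enum_rank y) 0) => f {x}.
move=> /eqP; rewrite eq_mx_pot_col => /eqP fr f0; apply/negP => /properP[sub [i ig nif]].
have fi j : cutv R r A (tail N j) = cutv R r A (head N j) ->
    f (tail N j) = f (head N j).
  move=> gj; apply/eqP; rewrite -subr_eq0 -ineq_mx_pot_col; apply/negPn/negP => jf.
  have /(subsetP sub) : j \in Defs.support (ineq_mx P *m pot_col f) by rewrite inE.
  by rewrite inE ineq_mx_pot_col gj subrr eqxx.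
have fA := const_on_conn (f := f) cA _ _ pA.
have fA' := const_on_conn (f := f) cA' _ _ (y := q).
have fE y : f y - f r = (f p - f q) * cutv R r A y.
  have H z : f z = (if z \in A then f p else f q).
    case: ifPn => zA; [apply: fA|apply: fA'] => //; rewrite ?inE //.
      by move=> j tj hj; apply: fi; rewrite /cutv tj hj.
    by move=> j; rewrite !inE => tj hj; apply: fi; rewrite /cutv (negPf tj) (negPf hj).
  by rewrite (H y) (H r) /cutv; case: (y \in A) (r \in A) => -[] /=; lra.
have fpq : f p - f q != 0.
  apply: contraNneq f0 => fpq; apply/eqP/colP => j; rewrite !mxE.
  by have := fE (enum_val j); rewrite fr fpq mul0r subr0.
move: ig nif; rewrite !inE !ineq_mx_pot_col negbK => gi.
have -> : f (tail N i) - f (head N i) =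
    (f p - f q) * (cutv R r A (tail N i) - cutv R r A (head N i)).
  by have := fE (tail N i); have := fE (head N i); lra.
by rewrite mulf_eq0 (negPf fpq) (negPf gi).
Qed.

Lemma circuit_step_pot_col f f' : f r = 0 -> feasible N f ->
  cut_step r N f f' -> circuit_step P (pot_col f) (pot_col f').
Proof.
move=> fr fF [A [alpha [cA cA' alpha0 f'E [i [ti hi f'i]]]]].
split; first by apply/points_pot_col.
exists (pot_col (cutv R r A)), alpha; split=> //.
- exact: circuits_cutv hi ti.
- by apply/colP => j; rewrite !mxE f'E; lra.
move=> beta ab.
have -> : pot_col f + beta *: pot_col (cutv R r A) =
    pot_col (fun x => f x + beta * cutv R r A x).
  by apply/colP => j; rewrite !mxE.
move=> /points_pot_col[_ /(_ i)]; move: f'i.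
by rewrite /tight !f'E /cutv hi (negPf ti) /=; lra.
Qed.

Lemma circuit_walk_pot_col k f f' : f r = 0 ->
  cut_walk r N k f f' -> circuit_walk P k (pot_col f) (pot_col f').
Proof.
move=> fr W; elim: W fr => {k f f'} [f _ fr|k f f' f'' fF ff' W IH fr].
  by exists (fun=> pot_col f).
have f'r : f' r = 0.
  by case: ff' => A [alpha [_ _ _ -> _]]; rewrite /cutv subrr mulr0 addr0.
have [y [y0 yk yS]] := IH f'r.
exists (fun i => if i is j.+1 then y j else pot_col f); split=> // -[_|i]; last exact: yS.
by rewrite y0; apply: circuit_step_pot_col.
Qed.

(* Otherwise moving [K] up and down by a small amount would stay inside. *)
Lemma vertex_cut f K p q : vertices P (pot_col f) -> p \in K -> q \notin K ->
  exists2 i, tight N f i & (tail N i \in K) != (head N i \in K).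
Proof.
move=> [/points_pot_col[fr fF] ext] pK qK; apply/not_exists2P => nT.
pose cr i := (tail N i \in K) != (head N i \in K).
pose slack i := cost N i - (f (head N i) - f (tail N i)).
(* The default 1 keeps [eps] positive even when no arc crosses [K]. *)
pose eps := \big[Order.min/1]_(i | cr i) slack i.
have eps0 : 0 < eps.
  apply: lt_bigmin => // i icr.
  rewrite lt_neqAle subr_ge0 fF andbT eq_sym subr_eq0 eq_sym; apply/eqP => fi.
  by case: (nT i).
have inP s : `|s| <= 1 -> points P (pot_col (fun x => f x + s * eps * cutv R r K x)).
  rewrite ler_norml => /andP[s1 s2].
  apply/points_pot_col; split; first by rewrite fr /cutv subrr mulr0 addr0.
  move=> i; have := fF i; have := @bigmin_le_cond _ _ _ 1 i cr slack.
  rewrite -/eps /cr /slack /cutv.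
  have : - eps <= s * eps by nra.
  have : s * eps <= eps by nra.
  move: (s * eps) => d.
  by case: (tail N i \in K) (head N i \in K) => -[] /= d1 d2 /=; try move=> /(_ isT); lra.
have up : points P (pot_col (fun x => f x + 1 * eps * cutv R r K x)).
  by apply: inP; rewrite normr1.
have down : points P (pot_col (fun x => f x + -1 * eps * cutv R r K x)).
  by apply: inP; rewrite normrN1.
(* The vertex is the midpoint of [up] and [down], so these agree; but they differ by [2 * eps] times
   the cut vector, whose values at [p] and [q] differ by 1. *)
have /colP eqx := ext _ _ (1 / 2) up down ltac:(lra) ltac:(lra)
  ltac:(by apply/colP => j; rewrite !mxE; lra).
have := eqx (enum_rank p); have := eqx (enum_rank q).
by rewrite !pot_colE /cutv pK (negPf qK) /=; lra.
Qed.

Lemma vertices_circuit_walk v w : connected_digraph E ->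
  vertices P v -> vertices P w ->
  exists2 k, (k <= 'C(#|V|, 2))%N & circuit_walk P k v w.
Proof.
rewrite -(pot_colK v) -(pot_colK w).
move: (fun x => v _ 0) (fun x => w _ 0) => f g {v w} cE vf vg.
have [fr fF] : f r = 0 /\ feasible N f by case: vf => /points_pot_col.
have [gr gF] : g r = 0 /\ feasible N g by case: vg => /points_pot_col.
have cT : conn N setT.
  (* No arc crosses the boundary of [B], so [B] is closed under undirected adjacency and contains
     every node connected to [z]. *)
  move=> B clB z _ zB; apply/subsetP => x _.
  rewrite -(closed_connect _ (cE z x)) // => y y' /orP[] yy'.
    by have := clB (enum_rank_in yy' (y, y')); rewrite /= enum_rankK_in // !inE => ->.
  by have := clB (enum_rank_in yy' (y', y)); rewrite /= enum_rankK_in // !inE => ->.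
have [|k kV W] := cut_walk_to (r := r) cT gF _ fF (etrans fr (esym gr)).
  by move=> K p q; apply: vertex_cut.
by exists k => //; apply: circuit_walk_pot_col.
Qed.
End DualNetworkFlow.

Theorem theorem2 (R : realType) (V : finType) (E : {set V * V}) (node0 : V)
    (c : 'cV[R]_#|E|) :
  loopless E -> connected_digraph E ->
  (circuit_diameter (dual_network_flow node0 c)
     <= ((#|V|%:R * (#|V|%:R - 1) / 2)%R)%:E)%E.
Proof.
move=> _ cE; apply: ge_ereal_sup => _ [v [w [vP wP ->]]].
have [k kV W] := vertices_circuit_walk cE vP wP.
apply: (@le_trans _ _ (k%:R)%:E); first by apply: ereal_inf_lbound; exists k.
rewrite lee_fin ler_pdivlMr // -natrM.
have V0 : (0 < #|V|)%N by apply/card_gt0P; exists node0.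
rewrite -(natrB _ V0) subn1 -natrM ler_nat.
apply: leq_trans (leq_mul kV (leqnn 2)) _.
(* [bin2] gives a rounded-down half; doubling it loses at most the parity bit, which is harmless for
   an upper bound. *)
by rewrite bin2 muln2 -[leqRHS]odd_double_half leq_addl.
Qed.
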